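(* Let $H$ be a Hopf algebra over a field $\Bbbk$, let $(D,\lambda)$ be a left $H$-comodule coalgebra, $\lambda(d)=d^{-1}\otimes d^{0}$, let $C$ be a subcoalgebra of $D$, and let $\pi\colon D\to C$ be a comultiplicative projection such that $$(I\otimes I\otimes\pi)(I\otimes\lambda\pi)\lambda(c)=(I\otimes I\otimes\pi)(I\otimes\lambda\otimes\varepsilon\pi)(I\otimes\tau\Delta)\lambda(c)$$ for all $c\in C$, i.e. $$c^{-1}\otimes\pi(c^{0})^{-1}\otimes\pi(\pi(c^{0})^{0})=c^{-1}\otimes (c^{0}{}_2)^{-1}\otimes\varepsilon(\pi(c^{0}{}_1))\,\pi((c^{0}{}_2)^{0}).$$ Then $C$ is a left partial $H$-comodule coalgebra via $\lambda'\colon C\to H\otimes C$, $\lambda'(c)=c^{-1}\otimes\pi(c^{0})$.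
   Context: All objects are over a field $\Bbbk$; coalgebras are counital, $\Delta(c)=c_1\otimes c_2$; $\tau_{V,W}\colon V\otimes W\to W\otimes V$ is the flip (in the displayed condition $\tau=\tau_{D,D}$), $m_H$ the multiplication of $H$. Left $H$-comodule coalgebra $(D,\lambda)$: $D$ a coalgebra, $\lambda\colon D\to H\otimes D$ linear such that for all $d$: $(\varepsilon_H\otimes I)\lambda(d)=d$; $(I\otimes\Delta_D)\lambda(d)=(m_H\otimes I\otimes I)(I\otimes\tau_{D,H}\otimes I)(\lambda\otimes\lambda)\Delta_D(d)$; $(I\otimes\lambda)\lambda(d)=(\Delta_H\otimes I)\lambda(d)$. Left partial $H$-comodule coalgebra $(C,\lambda')$: $C$ a coalgebra, $\lambda'\colon C\to H\otimes C$ linear such that for all $c$: $(\varepsilon_H\otimes I)\lambda'(c)=c$; $(I\otimes\Delta_C)\lambda'(c)=(m_H\otimes I\otimes I)(I\otimes\tau_{C,H}\otimes I)(\lambda'\otimes\lambda')\Delta_C(c)$; $(I\otimes\lambda')\lambda'(c)=(m_H\otimes I\otimes I)\{\nabla\otimes[(\Delta_H\otimes I)\lambda']\}\Delta_C(c)$, where $\nabla(c)=(I\otimes\varepsilon_C)\lambda'(c)$. A projection $\pi\colon D\to C$ is a linear map that, viewed as a map $D\to D$, satisfies $\pi\circ\pi=\pi$ and has image $C$; it is comultiplicative if $\Delta\circ\pi=(\pi\otimes\pi)\circ\Delta$ (not necessarily counit preserving). *)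

(* Defs.v *)
From HB Require Import structures.
From mathcomp Require Import all_boot all_algebra.
From mathcomp Require Import generic_quotient boolp.
From mathcomp Require Import finmap xfinmap monalg.

Set Implicit Arguments.
Unset Strict Implicit.
Unset Printing Implicit Defensive.

Import GRing.Theory.
Local Open Scope ring_scope.
Local Open Scope quotient_scope.

(* Construction of the tensor product of two (possibly infinite-dimensional)  *)
(* k-spaces: the free k-module on V * W modulo the submodule [tensor_rel]     *)
(* spanned by the bilinearity relations.                                      *)
Section FreeTensor.
Variables (k : fieldType) (V W : lmodType k).

Local Notation F := {malg k[(V * W)%type]}.
Local Notation gen v w := (<< (v, w) >> : F).

Inductive tensor_rel : F -> Prop :=
| tensor_rel0 : tensor_rel 0
| tensor_relP a x y :
    tensor_rel x -> tensor_rel y -> tensor_rel (a *: x + y)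
| tensor_rell a v v' w :
    tensor_rel (gen (a *: v + v') w - (a *: gen v w + gen v' w))
| tensor_relr a v w w' :
    tensor_rel (gen v (a *: w + w') - (a *: gen v w + gen v w')).

Lemma tensor_relZ a x : tensor_rel x -> tensor_rel (a *: x).
Proof.
move=> Hx; rewrite -[_ *: _]addr0.
by apply: tensor_relP => //; apply: tensor_rel0.
Qed.

Lemma tensor_relD x y : tensor_rel x -> tensor_rel y -> tensor_rel (x + y).
Proof. by move=> Hx Hy; rewrite -[x]scale1r; apply: tensor_relP. Qed.

Lemma tensor_relN x : tensor_rel x -> tensor_rel (- x).
Proof. by move=> Hx; rewrite -scaleN1r; apply: tensor_relZ. Qed.

Definition tensor_eq : rel F := fun x y => `[< tensor_rel (x - y) >].

Lemma tensor_eq_refl : reflexive tensor_eq.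
Proof. by move=> x; apply/asboolP; rewrite subrr; apply: tensor_rel0. Qed.

Lemma tensor_eq_sym : symmetric tensor_eq.
Proof. by move=> x y; apply/asboolP/asboolP => /tensor_relN; rewrite opprB. Qed.

Lemma tensor_eq_trans : transitive tensor_eq.
Proof.
move=> y x z /asboolP Hxy /asboolP Hyz; apply/asboolP.
by rewrite -(subrKA y); apply: tensor_relD.
Qed.

Canonical tensor_equiv :=
  EquivRel tensor_eq tensor_eq_refl tensor_eq_sym tensor_eq_trans.

Definition free_tensor := {eq_quot tensor_equiv}.
HB.instance Definition _ := Choice.on free_tensor.

Definition tensor_pi (x : F) : free_tensor := \pi_{eq_quot tensor_equiv} x.
Definition tensor_repr (t : free_tensor) : F := repr t.

Lemma tensor_reprK : cancel tensor_repr tensor_pi.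
Proof. exact: reprK. Qed.

Lemma tensor_piP x y : tensor_pi x = tensor_pi y <-> tensor_rel (x - y).
Proof.
by split=> [/eqmodP/asboolP//|Hxy]; apply/eqmodP/asboolP.
Qed.

Lemma tensor_piK x : tensor_rel (tensor_repr (tensor_pi x) - x).
Proof. by apply/tensor_piP; rewrite tensor_reprK. Qed.

Definition tensor_add (s t : free_tensor) : free_tensor :=
  tensor_pi (tensor_repr s + tensor_repr t).
Definition tensor_opp (s : free_tensor) : free_tensor :=
  tensor_pi (- tensor_repr s).
Definition tensor_scale (a : k) (s : free_tensor) : free_tensor :=
  tensor_pi (a *: tensor_repr s).

Lemma tensor_pi_add x y :
  tensor_pi (x + y) = tensor_add (tensor_pi x) (tensor_pi y).
Proof.
apply/esym/tensor_piP; rewrite opprD addrACA.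
by apply: tensor_relD; apply: tensor_piK.
Qed.

Lemma tensor_pi_opp x : tensor_pi (- x) = tensor_opp (tensor_pi x).
Proof.
by apply/esym/tensor_piP; rewrite -opprD; apply/tensor_relN/tensor_piK.
Qed.

Lemma tensor_pi_scale a x :
  tensor_pi (a *: x) = tensor_scale a (tensor_pi x).
Proof.
by apply/esym/tensor_piP; rewrite -scalerBr; apply/tensor_relZ/tensor_piK.
Qed.

Lemma tensor_addA : associative tensor_add.
Proof.
move=> r s t; rewrite -(tensor_reprK r) -(tensor_reprK s) -(tensor_reprK t).
by rewrite -!tensor_pi_add addrA.
Qed.

Lemma tensor_addC : commutative tensor_add.
Proof.
move=> s t; rewrite -(tensor_reprK s) -(tensor_reprK t).
by rewrite -!tensor_pi_add addrC.
Qed.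

Lemma tensor_add0 : left_id (tensor_pi 0) tensor_add.
Proof. by move=> s; rewrite -(tensor_reprK s) -tensor_pi_add add0r. Qed.

Lemma tensor_addN : left_inverse (tensor_pi 0) tensor_opp tensor_add.
Proof.
by move=> s; rewrite -(tensor_reprK s) -tensor_pi_opp -tensor_pi_add addNr.
Qed.

HB.instance Definition _ :=
  GRing.isZmodule.Build free_tensor
    tensor_addA tensor_addC tensor_add0 tensor_addN.

Lemma tensor_piD x y : tensor_pi (x + y) = tensor_pi x + tensor_pi y.
Proof. exact: tensor_pi_add. Qed.

Lemma tensor_scaleA a b s :
  tensor_scale a (tensor_scale b s) = tensor_scale (a * b) s.
Proof. by rewrite -(tensor_reprK s) -!tensor_pi_scale scalerA. Qed.

Lemma tensor_scale1 : left_id 1 tensor_scale.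
Proof. by move=> s; rewrite -(tensor_reprK s) -tensor_pi_scale scale1r. Qed.

Lemma tensor_scaleDr : right_distributive tensor_scale +%R.
Proof.
move=> a s t; rewrite -(tensor_reprK s) -(tensor_reprK t) -tensor_piD.
by rewrite -!tensor_pi_scale scalerDr tensor_piD.
Qed.

Lemma tensor_scaleDl s : {morph tensor_scale^~ s : a b / a + b}.
Proof.
move=> a b; rewrite -(tensor_reprK s) -!tensor_pi_scale.
by rewrite scalerDl tensor_piD.
Qed.

HB.instance Definition _ := GRing.Zmodule_isLmodule.Build k free_tensor
  tensor_scaleA tensor_scale1 tensor_scaleDr tensor_scaleDl.

Lemma tensor_pi_linear : linear tensor_pi.
Proof. by move=> a x y; rewrite tensor_piD tensor_pi_scale. Qed.

HB.instance Definition _ :=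
  GRing.isLinear.Build k F free_tensor *:%R tensor_pi tensor_pi_linear.

Definition free_tens (v : V) (w : W) : free_tensor := tensor_pi (gen v w).

Lemma free_tens_bilinear : bilinear_for *:%R *:%R free_tens.
Proof.
split=> [w a v v' | v a w w'] /=; rewrite -linearP; apply/tensor_piP.
- exact: tensor_rell.
- exact: tensor_relr.
Qed.

HB.instance Definition _ :=
  bilinear_isBilinear.Build k V W free_tensor *:%R *:%R free_tens free_tens_bilinear.

Lemma free_tensorP (t : free_tensor) :
  exists s : seq (V * W), t = \sum_(p <- s) free_tens p.1 p.2.
Proof.
rewrite -(tensor_reprK t) [tensor_repr t]monalgE raddf_sum /=.
set x := tensor_repr t.
exists [seq (x@_p *: p.1, p.2) | p <- msupp x]; rewrite big_map.
apply: eq_bigr => -[v w] _ /=; rewrite linearZl_LR /= -linearZ /=.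
congr tensor_pi; apply/malgP => q.
by rewrite mcoeffZ !mcoeffU mulrnAr mulr1.
Qed.

Section Lift.
Variables (U : lmodType k) (f : V -> W -> U).

Definition pre_lift (x : F) : U := \sum_(p <- msupp x) x@_p *: f p.1 p.2.

Lemma pre_liftEw (d : {fset V * W}) x : (msupp x `<=` d)%fset ->
  pre_lift x = \sum_(p <- d) x@_p *: f p.1 p.2.
Proof.
move=> le; rewrite [LHS](big_fset_incl _ le) => //= p _ /mcoeff_outdom ->.
by rewrite scale0r.
Qed.

Lemma pre_lift_linear : linear pre_lift.
Proof.
move=> a x y; pose d := (msupp x `|` msupp y `|` msupp (a *: x + y))%fset.
have sx : (msupp x `<=` d)%fset by rewrite /d -fsetUA fsubsetUl.
have sy : (msupp y `<=` d)%fset by rewrite /d fsetUAC fsubsetUr.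
rewrite (pre_liftEw sx) (pre_liftEw sy) (@pre_liftEw d) ?fsubsetUr //.
rewrite scaler_sumr -big_split /=; apply: eq_bigr => p _.
by rewrite mcoeffD mcoeffZ scalerDl scalerA.
Qed.

HB.instance Definition _ :=
  GRing.isLinear.Build k F U *:%R pre_lift pre_lift_linear.

Lemma pre_lift_gen v w : pre_lift (gen v w) = f v w.
Proof. by rewrite (pre_liftEw msuppU_le) big_seq_fset1 mcoeffUU scale1r. Qed.

Lemma pre_lift_rel : bilinear_for *:%R *:%R f ->
  forall x, tensor_rel x -> pre_lift x = 0.
Proof.
move=> [fl fr] x; elim=> {x} [|a x y _ Hx _ Hy|a v v' w|a v w w'].
- by rewrite linear0.
- by rewrite linearP /= Hx Hy scaler0 addr0.
- by rewrite linearB linearP /= !pre_lift_gen (fl w a v v') subrr.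
- by rewrite linearB linearP /= !pre_lift_gen (fr v a w w') subrr.
Qed.

End Lift.

Definition free_tensor_lift (U : lmodType k) (f : {bilinear V -> W -> U})
  (t : free_tensor) : U := pre_lift f (tensor_repr t).

Section LiftTheory.
Variables (U : lmodType k) (f : {bilinear V -> W -> U}).

Lemma free_tensor_lift_pi x : free_tensor_lift f (tensor_pi x) = pre_lift f x.
Proof.
apply/eqP; rewrite -subr_eq0 -linearB; apply/eqP.
apply: pre_lift_rel (tensor_piK x).
by split=> [w|v] a u u' /=; [rewrite linearPl|rewrite linearPr].
Qed.

Lemma free_tensor_lift_linear : linear (free_tensor_lift f).
Proof.
move=> a s t; rewrite -(tensor_reprK s) -(tensor_reprK t) -linearP.
by rewrite !free_tensor_lift_pi linearP.
Qed.

HB.instance Definition _ :=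
  GRing.isLinear.Build k free_tensor U *:%R (free_tensor_lift f) free_tensor_lift_linear.

Lemma free_tensor_liftE v w : free_tensor_lift f (free_tens v w) = f v w.
Proof. by rewrite free_tensor_lift_pi pre_lift_gen. Qed.

End LiftTheory.

End FreeTensor.

(* [tp_liftE] and [tp_gen] are the universal property of the tensor product   *)
(* (generation by pure tensors gives uniqueness of the lift). The witness     *)
(* [tensor_productP] is opaque so that unification never unfolds the          *)
(* construction: V ⊗ W is only known through its universal property, which    *)
(* determines it up to a unique isomorphism.                                  *)
Record tensor_product (k : fieldType) (V W : lmodType k) := TensorProduct {
  tp_space : lmodType k;
  tp_tens : {bilinear V -> W -> tp_space};
  tp_lift : forall U : lmodType k,
    {bilinear V -> W -> U} -> {linear tp_space -> U};
  tp_liftE : forall (U : lmodType k) (f : {bilinear V -> W -> U}) v w,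
    tp_lift f (tp_tens v w) = f v w;
  tp_gen : forall t : tp_space,
    exists s : seq (V * W), t = \sum_(p <- s) (tp_tens p.1 p.2 : tp_space)
}.

Lemma tensor_productP (k : fieldType) (V W : lmodType k) : tensor_product V W.
Proof.
exact: (@TensorProduct k V W (@free_tensor k V W) (@free_tens k V W)
  (fun U f => @free_tensor_lift k V W U f)
  (@free_tensor_liftE k V W) (@free_tensorP k V W)).
Qed.

Section Tensor.
Variables (k : fieldType) (V W : lmodType k).

Definition tensor : lmodType k := tp_space (tensor_productP V W).
Definition tens : {bilinear V -> W -> tensor} := tp_tens (tensor_productP V W).
Definition tensor_lift (U : lmodType k) (f : {bilinear V -> W -> U}) :
  {linear tensor -> U} := tp_lift (tensor_productP V W) f.

Lemma tensor_liftE (U : lmodType k) (f : {bilinear V -> W -> U}) v w :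
  tensor_lift f (tens v w) = f v w.
Proof. exact: tp_liftE. Qed.

Lemma tensorP (t : tensor) :
  exists s : seq (V * W), t = \sum_(p <- s) (tens p.1 p.2 : tensor).
Proof. exact: tp_gen. Qed.

Lemma tensor_ext (U : lmodType k) (f g : {linear tensor -> U}) :
  (forall v w, f (tens v w) = g (tens v w)) -> f =1 g.
Proof.
move=> fg t; have [s ->] := tensorP t.
by rewrite !linear_sum; apply: eq_bigr => p _; apply: fg.
Qed.

End Tensor.

Notation "V ⊗ W" := (tensor V W) (at level 40, left associativity).
Notation "v \ot w" := (tens _ _ v w)
  (at level 40, left associativity) : ring_scope.
Arguments tensor_lift {k V W U} f : simpl never.

Section TensorMaps.
Variable k : fieldType.
Implicit Types U V W : lmodType k.

Section Map.
Variables (V V' W W' : lmodType k).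
Variables (f : {linear V -> V'}) (g : {linear W -> W'}).

Definition tens_map (v : V) (w : W) : V' ⊗ W' := f v \ot g w.

Lemma tens_map_bilinear : bilinear_for *:%R *:%R tens_map.
Proof.
split=> [w a v v' | v a w w'] /=; rewrite /tens_map linearP.
- by rewrite linearPl.
- by rewrite linearPr.
Qed.

HB.instance Definition _ :=
  bilinear_isBilinear.Build k V W (V' ⊗ W') *:%R *:%R
    tens_map tens_map_bilinear.

Definition tensor_map : {linear V ⊗ W -> V' ⊗ W'} := tensor_lift tens_map.

Lemma tensor_mapE v w : tensor_map (v \ot w) = f v \ot g w.
Proof. exact: tensor_liftE. Qed.

Lemma tensor_map_sum (s : seq (V * W)) :
  tensor_map (\sum_(p <- s) (p.1 \ot p.2 : V ⊗ W)) =
  \sum_(p <- s) (f p.1 \ot g p.2 : V' ⊗ W').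
Proof. by rewrite linear_sum; apply: eq_bigr => p _; apply: tensor_mapE. Qed.

End Map.

Lemma tensor_map_linearl (V V' W W' : lmodType k) (a : k)
    (f f1 f2 : {linear V -> V'}) (g : {linear W -> W'}) :
  (forall v, f v = a *: f1 v + f2 v) ->
  forall t, tensor_map f g t = a *: tensor_map f1 g t + tensor_map f2 g t.
Proof.
move=> fE t; have [s ->] := tensorP t.
rewrite !tensor_map_sum scaler_sumr -big_split /=.
by apply: eq_bigr => p _; rewrite fE linearPl.
Qed.

Lemma tensor_map_linearr (V V' W W' : lmodType k) (a : k)
    (f : {linear V -> V'}) (g g1 g2 : {linear W -> W'}) :
  (forall w, g w = a *: g1 w + g2 w) ->
  forall t, tensor_map f g t = a *: tensor_map f g1 t + tensor_map f g2 t.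
Proof.
move=> gE t; have [s ->] := tensorP t.
rewrite !tensor_map_sum scaler_sumr -big_split /=.
by apply: eq_bigr => p _; rewrite gE linearPr.
Qed.

End TensorMaps.

Arguments tensor_map {k V V' W W'} f g : simpl never.
Notation "f \ox g" := (tensor_map f g)
  (at level 40, left associativity) : ring_scope.

Section TensorIsos.
Variable k : fieldType.

Section Flip.
Variables V W : lmodType k.

Definition tens_flip (v : V) (w : W) : W ⊗ V := w \ot v.

Lemma tens_flip_bilinear : bilinear_for *:%R *:%R tens_flip.
Proof.
by split=> [w a v v' | v a w w']; rewrite /tens_flip (linearPr, linearPl).
Qed.

HB.instance Definition _ :=
  bilinear_isBilinear.Build k V W (W ⊗ V) *:%R *:%R tens_flip tens_flip_bilinear.

Definition tensor_flip : {linear V ⊗ W -> W ⊗ V} := tensor_lift tens_flip.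

Lemma tensor_flipE v w : tensor_flip (v \ot w) = w \ot v.
Proof. exact: tensor_liftE. Qed.

End Flip.

Section Assoc.
Variables U V W : lmodType k.

Definition tens_assoc (t : U ⊗ V) (w : W) : U ⊗ (V ⊗ W) :=
  (idfun \ox applyr (tens V W) w) t.
Definition tens_assoc_inv (u : U) (t : V ⊗ W) : U ⊗ V ⊗ W :=
  (tens U V u \ox idfun) t.

Lemma tens_assoc_bilinear : bilinear_for *:%R *:%R tens_assoc.
Proof.
split=> [w a s t | t a w w']; rewrite /tens_assoc; first by rewrite linearP.
by apply: tensor_map_linearr => v; apply: linearPr.
Qed.

Lemma tens_assoc_inv_bilinear : bilinear_for *:%R *:%R tens_assoc_inv.
Proof.
split=> [t a u u' | u a s t]; rewrite /tens_assoc_inv; last by rewrite linearP.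
by apply: tensor_map_linearl => v; apply: linearPl.
Qed.

HB.instance Definition _ := bilinear_isBilinear.Build k (U ⊗ V) W
  (U ⊗ (V ⊗ W)) *:%R *:%R tens_assoc tens_assoc_bilinear.
HB.instance Definition _ := bilinear_isBilinear.Build k U (V ⊗ W)
  (U ⊗ V ⊗ W) *:%R *:%R tens_assoc_inv tens_assoc_inv_bilinear.

Definition tensor_assoc : {linear U ⊗ V ⊗ W -> U ⊗ (V ⊗ W)} :=
  tensor_lift tens_assoc.
Definition tensor_assoc_inv : {linear U ⊗ (V ⊗ W) -> U ⊗ V ⊗ W} :=
  tensor_lift tens_assoc_inv.

Lemma tensor_assocE u v w :
  tensor_assoc (u \ot v \ot w) = u \ot (v \ot w).
Proof. by rewrite tensor_liftE; apply: tensor_mapE. Qed.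

Lemma tensor_assoc_invE u v w :
  tensor_assoc_inv (u \ot (v \ot w)) = u \ot v \ot w.
Proof. by rewrite tensor_liftE; apply: tensor_mapE. Qed.

End Assoc.

Section Unit.
Variable V : lmodType k.

Definition tens_unitl (a : k^o) (v : V) : V := a *: v.
Definition tens_unitr (v : V) (a : k^o) : V := a *: v.

Lemma tens_unitl_bilinear : bilinear_for *:%R *:%R tens_unitl.
Proof.
split=> [v a b b' | b a v v'] /=; rewrite /tens_unitl.
- by rewrite scalerDl scalerA.
- by rewrite scalerDr !scalerA mulrC.
Qed.

Lemma tens_unitr_bilinear : bilinear_for *:%R *:%R tens_unitr.
Proof.
by split=> [b a v v' | v a b b']; case: tens_unitl_bilinear => l r;
  [apply: r | apply: l].
Qed.

HB.instance Definition _ := bilinear_isBilinear.Build k k^o V V *:%R *:%R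
  tens_unitl tens_unitl_bilinear.
HB.instance Definition _ := bilinear_isBilinear.Build k V k^o V *:%R *:%R
  tens_unitr tens_unitr_bilinear.

Definition tensor_unitl : {linear k^o ⊗ V -> V} := tensor_lift tens_unitl.
Definition tensor_unitr : {linear V ⊗ k^o -> V} := tensor_lift tens_unitr.

Lemma tensor_unitlE a v : tensor_unitl (a \ot v) = a *: v.
Proof. exact: tensor_liftE. Qed.

Lemma tensor_unitrE v a : tensor_unitr (v \ot a) = a *: v.
Proof. exact: tensor_liftE. Qed.

End Unit.

(* I ⊗ tau ⊗ I, on suitably bracketed factors *)
Section Interchange.
Variables A B C D : lmodType k.

Definition tensor_interchange : {linear A ⊗ B ⊗ (C ⊗ D) -> A ⊗ C ⊗ (B ⊗ D)} :=
  tensor_assoc_inv A C (B ⊗ D)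
  \o (idfun \ox (tensor_assoc C B D \o (tensor_flip B C \ox idfun)
                  \o tensor_assoc_inv B C D))
  \o tensor_assoc A B (C ⊗ D).

Lemma tensor_interchangeE a b c d :
  tensor_interchange (a \ot b \ot (c \ot d)) = a \ot c \ot (b \ot d).
Proof.
rewrite /tensor_interchange /= tensor_assocE tensor_mapE /= tensor_assoc_invE.
by rewrite tensor_mapE /= tensor_flipE tensor_assocE tensor_assoc_invE.
Qed.

End Interchange.

Section Mul.
Variable A : algType k.

Definition tens_mul (x y : A) : A := x * y.

Lemma tens_mul_bilinear : bilinear_for *:%R *:%R tens_mul.
Proof.
split=> [y a x x' | x a y y'] /=; rewrite /tens_mul.
- by rewrite mulrDl scalerAl.
- by rewrite mulrDr scalerAr.
Qed.

HB.instance Definition _ := bilinear_isBilinear.Build k A A A *:%R *:%R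
  tens_mul tens_mul_bilinear.

Definition tensor_mul : {linear A ⊗ A -> A} := tensor_lift tens_mul.

Lemma tensor_mulE x y : tensor_mul (x \ot y) = x * y.
Proof. exact: tensor_liftE. Qed.

End Mul.
End TensorIsos.

Arguments tensor_flip {k V W} : simpl never.
Arguments tensor_assoc {k U V W} : simpl never.
Arguments tensor_assoc_inv {k U V W} : simpl never.
Arguments tensor_unitl {k V} : simpl never.
Arguments tensor_unitr {k V} : simpl never.
Arguments tensor_interchange {k A B C D} : simpl never.
Arguments tensor_mul {k A} : simpl never.

(* Iterated tensor products are not associative on the nose, and k ⊗ V is not *)
(* V: the identifications usually left implicit are the explicit maps         *)
(* [tensor_assoc], [tensor_unitl] and [tensor_unitr].                         *)
HB.mixin Record isCoalgebra (k : fieldType) C of GRing.Lmodule k C := {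
  comul : {linear C -> C ⊗ C};
  counit : {linear C -> k^o};
  comulA : forall c,
    tensor_assoc ((comul \ox idfun) (comul c)) = (idfun \ox comul) (comul c);
  counitl : forall c, tensor_unitl ((counit \ox idfun) (comul c)) = c;
  counitr : forall c, tensor_unitr ((idfun \ox counit) (comul c)) = c
}.

#[short(type="coalgType")]
HB.structure Definition Coalgebra (k : fieldType) :=
  {C of GRing.Lmodule k C & isCoalgebra k C}.

HB.mixin Record isBialgebra (k : fieldType) H
    of GRing.Algebra k H & Coalgebra k H := {
  comul1 : comul (1 : H) = 1 \ot 1;
  comulM : forall x y : H, comul (x * y) =
    (tensor_mul \ox tensor_mul) (tensor_interchange (comul x \ot comul y));
  counit1 : counit (1 : H) = 1;
  counitM : forall x y : H, counit (x * y) = counit x * counit y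
}.

#[short(type="bialgType")]
HB.structure Definition Bialgebra (k : fieldType) :=
  {H of GRing.Algebra k H & Coalgebra k H & isBialgebra k H}.

HB.mixin Record isHopfAlgebra (k : fieldType) H of Bialgebra k H := {
  antipode : {linear H -> H};
  antipodel : forall x : H,
    tensor_mul ((antipode \ox idfun) (comul x)) = (counit x : k) *: 1;
  antipoder : forall x : H,
    tensor_mul ((idfun \ox antipode) (comul x)) = (counit x : k) *: 1
}.

#[short(type="hopfAlgType")]
HB.structure Definition HopfAlgebra (k : fieldType) :=
  {H of Bialgebra k H & isHopfAlgebra k H}.

(* A subcoalgebra of D is a subspace S with comul (S) contained in S ⊗ S; the *)
(* induced structure on the subtype C of S is the one making the inclusion    *)
(* [val : C -> D] a morphism of coalgebras.                                   *)
HB.mixin Record isSubCoalgebra (k : fieldType) (D : coalgType k) (S : pred D) C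
    of @GRing.SubLmodule k D S C & Coalgebra k C := {
  val_comul : forall c : C,
    ((val : {linear C -> D}) \ox (val : {linear C -> D})) (comul c)
      = comul (val c);
  val_counit : forall c : C, counit c = counit (val c) :> k
}.

#[short(type="subCoalgType")]
HB.structure Definition SubCoalgebra (k : fieldType) (D : coalgType k)
    (S : pred D) :=
  {C of @GRing.SubLmodule k D S C & Coalgebra k C & isSubCoalgebra k D S C}.

Section ComoduleCoalgebra.
Variables (k : fieldType) (H : bialgType k) (D : coalgType k).
Variable lam : {linear D -> H ⊗ D}.

Definition comodule_coalgebra : Prop :=
  [/\ forall d, tensor_unitl ((counit \ox idfun) (lam d)) = d,
      forall d, (idfun \ox comul) (lam d) =
        (tensor_mul \ox idfun) (tensor_interchange ((lam \ox lam) (comul d)))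
    & forall d, (idfun \ox lam) (lam d) =
        tensor_assoc ((comul \ox idfun) (lam d))].

Definition nabla : {linear D -> H} :=
  tensor_unitr \o (idfun \ox counit) \o lam.

(* In the last axiom (Δ ⊗ I) lam is first rebracketed to H ⊗ (H ⊗ D), so that *)
(* the two left factors of H ⊗ (H ⊗ (H ⊗ D)) can be multiplied.               *)
Definition partial_comodule_coalgebra : Prop :=
  [/\ forall d, tensor_unitl ((counit \ox idfun) (lam d)) = d,
      forall d, (idfun \ox comul) (lam d) =
        (tensor_mul \ox idfun) (tensor_interchange ((lam \ox lam) (comul d)))
    & forall d, (idfun \ox lam) (lam d) =
        (tensor_mul \ox idfun) (tensor_assoc_inv
          ((nabla \ox (tensor_assoc \o (comul \ox idfun) \o lam)) (comul d)))].

End ComoduleCoalgebra.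

Section Projection.
Variables (k : fieldType) (D : coalgType k) (S : pred D) (C : subCoalgType S).
Variable pi : {linear D -> C}.

(* [val \o pi] is pi viewed as a map D -> D. *)
Definition is_projection : Prop :=
  (forall d, val (pi (val (pi d))) = val (pi d)) /\
  (forall d, S d <-> exists e, val (pi e) = d).

Definition comultiplicative : Prop :=
  forall d, comul (pi d) = (pi \ox pi) (comul d).

End Projection.

(* Main.v *)
Require Import Defs.
From HB Require Import structures.
From mathcomp Require Import all_boot all_algebra.

Set Implicit Arguments.
Unset Strict Implicit.
Unset Printing Implicit Defensive.

Import GRing.Theory.
Local Open Scope ring_scope.

(** In Sweedler notation, write d^-1 ⊗ d^0 for [lam d]; the coaction of [C]
    is c^-1 ⊗ pi (c^0). Its counit axiom is that of [D] followed by [pi],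
    which fixes [C]. Its compatibility with the comultiplication is that of
    [D] followed by [pi ⊗ pi], because [pi] is comultiplicative and [C] is a
    subcoalgebra.

    Iterating the coaction of [C] gives the left-hand side of the displayed
    hypothesis on [pi], which says that this equals

      c^-1 ⊗ (c^0_2)^-1 ⊗ counit (pi (c^0_1)) pi ((c^0_2)^0).

    Unlike the iterated coaction, where the inner [pi] stands between two
    uses of [lam], this expression only involves c through
    c^-1 ⊗ c^0_1 ⊗ c^0_2. The second axiom for [D] replaces the latter by
    (c_1)^-1 (c_2)^-1 ⊗ (c_1)^0 ⊗ (c_2)^0. The scalar counit (pi ((c_1)^0))
    then combines with (c_1)^-1 into nabla (c_1) ([mul_contract_interchange]),
    and coassociativity of [lam] on c_2 gives the third axiom.

    All other steps are functoriality of the tensor product and naturality of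
    its rebracketings. *)

(* Keeps [/=] from exposing the rebracketings that define the interchange. *)
Local Opaque tensor_interchange.

Section Naturality.
Variable k : fieldType.

Lemma eq_tensor_map (V V' W W' : lmodType k)
    (f f' : {linear V -> V'}) (g g' : {linear W -> W'}) :
  f =1 f' -> g =1 g' -> f \ox g =1 f' \ox g'.
Proof. by move=> ff gg; apply: tensor_ext => v w; rewrite !tensor_mapE ff gg. Qed.

Lemma tensor_map_comp (V V' V'' W W' W'' : lmodType k)
    (f : {linear V' -> V''}) (f' : {linear V -> V'})
    (g : {linear W' -> W''}) (g' : {linear W -> W'}) t :
  (f \ox g) ((f' \ox g') t) = ((f \o f') \ox (g \o g')) t.
Proof.
move: t; apply: (@tensor_ext _ _ _ _ ((f \ox g) \o (f' \ox g'))) => v w /=.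
by rewrite !tensor_mapE.
Qed.

Lemma tensor_map_id (V W : lmodType k) (t : V ⊗ W) : (idfun \ox idfun) t = t.
Proof. by apply: (@tensor_ext _ _ _ _ _ idfun) t => v w; rewrite tensor_mapE. Qed.

Lemma tensor_map_swap (V V' W W' : lmodType k)
    (f : {linear V -> V'}) (g : {linear W -> W'}) t :
  (f \ox idfun) ((idfun \ox g) t) = (idfun \ox g) ((f \ox idfun) t).
Proof. by rewrite !tensor_map_comp; apply: eq_tensor_map. Qed.

Lemma tensor_ext4 (A B C D U : lmodType k)
    (f g : {linear A ⊗ B ⊗ (C ⊗ D) -> U}) :
  (forall a b c d, f (a \ot b \ot (c \ot d)) = g (a \ot b \ot (c \ot d))) ->
  f =1 g.
Proof.
move=> fg; apply: tensor_ext => p q.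
(* Both sides are linear in p for fixed q, and in q for fixed pure p. *)
apply: (@tensor_ext _ _ _ _ (f \o applyr (tens _ _) q)
  (g \o applyr (tens _ _) q)) => a b /=; rewrite /applyr.
apply: (@tensor_ext _ _ _ _ (f \o tens _ _ (a \ot b))
  (g \o tens _ _ (a \ot b))) => c d; exact: fg.
Qed.

Lemma tensor_interchange_map (A A' B B' C C' D D' : lmodType k)
    (a : {linear A -> A'}) (b : {linear B -> B'})
    (c : {linear C -> C'}) (d : {linear D -> D'}) t :
  tensor_interchange (((a \ox b) \ox (c \ox d)) t) =
  ((a \ox c) \ox (b \ox d)) (tensor_interchange t).
Proof.
move: t; apply: (@tensor_ext4 _ _ _ _ _
  (tensor_interchange \o ((a \ox b) \ox (c \ox d)))
  (((a \ox c) \ox (b \ox d)) \o tensor_interchange)) => x y z w /=.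
by rewrite !(tensor_interchangeE, tensor_mapE).
Qed.

Lemma tensor_assoc_map (A A' B B' C C' : lmodType k)
    (a : {linear A -> A'}) (b : {linear B -> B'}) (c : {linear C -> C'}) t :
  tensor_assoc (((a \ox b) \ox c) t) = (a \ox (b \ox c)) (tensor_assoc t).
Proof.
move: t; apply: (@tensor_ext _ _ _ _ (tensor_assoc \o ((a \ox b) \ox c))
  ((a \ox (b \ox c)) \o tensor_assoc)) => p z /=.
apply: (@tensor_ext _ _ _ _
  (tensor_assoc \o ((a \ox b) \ox c) \o applyr (tens _ _) z)
  ((a \ox (b \ox c)) \o tensor_assoc \o applyr (tens _ _) z)) => x y /=.
by rewrite /applyr !(tensor_assocE, tensor_mapE).
Qed.

Lemma tensor_unitl_map (V W : lmodType k) (f : {linear V -> W}) t :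
  tensor_unitl ((idfun \ox f) t) = f (tensor_unitl t).
Proof.
move: t; apply: (@tensor_ext _ _ _ _ (tensor_unitl \o (idfun \ox f))
  (f \o tensor_unitl)) => a v /=.
by rewrite tensor_mapE !tensor_unitlE linearZ.
Qed.

Lemma tensor_unitr_map (V W : lmodType k) (f : {linear V -> W}) t :
  f (tensor_unitr t) = tensor_unitr ((f \ox idfun) t).
Proof.
move: t; apply: (@tensor_ext _ _ _ _ (f \o tensor_unitr)
  (tensor_unitr \o (f \ox idfun))) => v a /=.
by rewrite tensor_mapE !tensor_unitrE linearZ.
Qed.

(** A scalar can be moved between tensor factors, so the second leg of the
    left factor may be contracted by [e] before the first legs are multiplied.
    With [e] the counit after a projection this is how [nabla] arises. *)
Lemma mul_contract_interchange (A : algType k) (V W B X : lmodType k)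
    (e : {linear V -> k^o}) (f : {linear W -> B ⊗ X})
    (t : A ⊗ V ⊗ (A ⊗ W)) :
  (tensor_mul \ox (tensor_unitr \o (f \ox e) \o tensor_flip))
    (tensor_interchange t) =
  (tensor_mul \ox idfun) (tensor_assoc_inv
    (((tensor_unitr \o (idfun \ox e)) \ox (idfun \ox f)) t)).
Proof.
move: t; apply: (@tensor_ext4 _ _ _ _ _
  ((tensor_mul \ox (tensor_unitr \o (f \ox e) \o tensor_flip))
    \o tensor_interchange)
  ((tensor_mul \ox idfun) \o tensor_assoc_inv
     \o ((tensor_unitr \o (idfun \ox e)) \ox (idfun \ox f)))) => a v b w /=.
rewrite tensor_interchangeE !tensor_mapE /= tensor_flipE !tensor_mapE.
rewrite !tensor_unitrE tensor_mulE tensor_assoc_invE tensor_mapE tensor_mulE /=.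
by rewrite -scalerAl linearZl_LR linearZr.
Qed.

End Naturality.

Theorem proposition4p18 (k : fieldType) (H : hopfAlgType k)
    (D : coalgType k) (lam : {linear D -> H ⊗ D})
    (S : pred D) (C : subCoalgType S) (pi : {linear D -> C}) :
  comodule_coalgebra lam ->
  is_projection pi ->
  comultiplicative pi ->
  (forall c : C,
    (idfun \ox (idfun \ox pi)) ((idfun \ox (lam \o val \o pi)) (lam (val c))) =
    (idfun \ox (idfun \ox pi))
      ((idfun \ox (tensor_unitr \o (lam \ox (counit \o pi))))
        ((idfun \ox (tensor_flip \o comul)) (lam (val c))))) ->
  partial_comodule_coalgebra ((idfun \ox pi) \o lam \o val).
Proof.
move=> [lam1 lamM lamA] [pi_proj imageP] piM hyp.
have piK c : pi (val c) = c.
  have [|d dc] := (imageP (val c)).1; first exact: valP.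
  by apply: val_inj; rewrite -dc pi_proj.
split=> [c | c | c] /=.
- by rewrite tensor_map_swap tensor_unitl_map lam1 piK.
- rewrite tensor_map_comp.
  transitivity ((idfun \ox (pi \ox pi)) ((idfun \ox comul) (lam (val c)))).
    by rewrite tensor_map_comp; apply: eq_tensor_map => // d; apply: piM.
  rewrite lamM -val_comul !tensor_map_comp.
  transitivity ((tensor_mul \ox idfun) (tensor_interchange
    (((idfun \ox pi) \ox (idfun \ox pi))
       (((lam \o val) \ox (lam \o val)) (comul c))))).
    by rewrite tensor_interchange_map tensor_map_comp; apply: eq_tensor_map => // p;
      rewrite /= tensor_map_id.
  rewrite tensor_map_comp; congr ((tensor_mul \ox idfun) (tensor_interchange _)).
  exact: eq_tensor_map.
- transitivity ((idfun \ox (idfun \ox pi))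
                  ((idfun \ox (lam \o val \o pi)) (lam (val c)))).
    by rewrite !tensor_map_comp; apply: eq_tensor_map.
  rewrite hyp !tensor_map_comp.
  pose Phi : {linear D ⊗ D -> H ⊗ C} :=
    tensor_unitr \o (((idfun \ox pi) \o lam) \ox (counit \o pi)) \o tensor_flip.
  (* Phi (x ⊗ y) = counit (pi x) (y^-1 ⊗ pi (y^0)) *)
  transitivity ((idfun \ox Phi) ((idfun \ox comul) (lam (val c)))).
    rewrite tensor_map_comp; apply: eq_tensor_map => // d.
    rewrite /= tensor_unitr_map tensor_map_comp; congr (tensor_unitr _).
    exact: eq_tensor_map.
  rewrite lamM -val_comul !tensor_map_comp.
  transitivity ((tensor_mul \ox Phi)
    (tensor_interchange (((lam \o val) \ox (lam \o val)) (comul c)))).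
    exact: eq_tensor_map.
  rewrite mul_contract_interchange tensor_map_comp.
  congr (_ (tensor_assoc_inv _)); apply: eq_tensor_map => x /=.
    (* the contraction of the left factor is nabla *)
    by rewrite tensor_map_comp; congr (tensor_unitr _); apply: eq_tensor_map.
  transitivity ((idfun \ox (idfun \ox pi)) ((idfun \ox lam) (lam (val x)))).
    by rewrite tensor_map_comp; apply: eq_tensor_map.
  rewrite lamA -tensor_assoc_map !tensor_map_comp; congr (tensor_assoc _).
  by apply: eq_tensor_map => // h; rewrite /= tensor_map_id.
Qed.
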